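(* Let $A$ be an srl-monoid. Then the lattice $\mathrm{Con}(A)$ of congruences of $A$ is order isomorphic (under inclusion) to the set of strongly convex subalgebras of $A$ ordered by inclusion. The isomorphism is given by $\theta\mapsto e/\theta$, with inverse $H\mapsto \theta_H$, where $\theta_H=\{(a,b)\in A\times A: a\cdot h\leq b \text{ and } b\cdot h\leq a \text{ for some } h\in H\}$.
   Context: A commutative l-monoid is an algebra $(A,\wedge,\vee,\cdot,e)$ of type $(2,2,2,0)$ such that $(A,\wedge,\vee)$ is a lattice, $(A,\cdot,e)$ is a commutative monoid and $(a\vee b)\cdot c=(a\cdot c)\vee(b\cdot c)$ for all $a,b,c\in A$. An algebra $(A,\wedge,\vee,\cdot,\rightarrow,e)$ of type $(2,2,2,2,0)$ is an srl-monoid if $(A,\wedge,\vee,\cdot,e)$ is a commutative l-monoid and there is a subalgebra $Q$ of $(A,\wedge,\vee,\cdot,e)$ such that for all $a,b\in A$ the set $\{q\in Q: a\cdot q\leq b\}$ has a maximum and $a\rightarrow b$ equals this maximum. A convex subalgebra of $A$ is a subalgebra $H$ of $(A,\wedge,\vee,\cdot,\rightarrow,e)$ such that whenever $a,b\in H$, $c\in A$ and $a\le c\le b$, then $c\in H$. A strongly convex subalgebra is a convex subalgebra $H$ such that for every $a\in A$ and $h\in H$ with $a\cdot h\leq e\leq h\rightarrow a$ one has $a\in H$. $e/\theta$ denotes the $\theta$-class of $e$. *)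

(* Defs.v *)
From HB Require Import structures.
From Corelib Require Export RelationClasses.
From mathcomp Require Export all_boot all_order.
From mathcomp Require Export boolp classical_sets.

Set Implicit Arguments.
Unset Strict Implicit.
Unset Printing Implicit Defensive.

Import Order.TTheory.

Local Open Scope group_scope.
Local Open Scope order_scope.

(** The lattice is MathComp's [latticeType], the monoid (A, *, 1) with e = 1
    is MathComp's [monoidType]. *)
HB.mixin Record LatticeMonoid_isCLMonoid d A
    of Order.Lattice d A & Monoid A := {
  clmulC : commutative ( *%g : A -> A -> A);
  clmul_joinl : left_distributive ( *%g : A -> A -> A) Order.join
}.

#[short(type="clMonoidType")]
HB.structure Definition CLMonoid (d : Order.disp_t) :=
  { A of Order.Lattice d A & Monoid A & LatticeMonoid_isCLMonoid d A }.

Record cl_subalgebra (d : Order.disp_t) (A : clMonoidType d) (Q : set A) :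
    Prop := ClSubalgebra {
  sub_one  : Q 1;
  sub_mul  : forall a b, Q a -> Q b -> Q (a * b);
  sub_meet : forall a b, Q a -> Q b -> Q (a `&` b);
  sub_join : forall a b, Q a -> Q b -> Q (a `|` b)
}.

Definition is_maximum (d : Order.disp_t) (T : porderType d) (S : set T)
  (m : T) : Prop := S m /\ ubound S m.

(** Q is only required to exist: it is not part of the signature. *)
HB.mixin Record CLMonoid_isSRLMonoid d A of CLMonoid d A := {
  srl_imp : A -> A -> A;
  srl_impP : exists Q : set A, cl_subalgebra Q /\
    forall a b : A,
      is_maximum [set q : A | Q q /\ a * q <= b]%classic (srl_imp a b)
}.

#[short(type="srlMonoidType")]
HB.structure Definition SRLMonoid (d : Order.disp_t) :=
  { A of CLMonoid d A & CLMonoid_isSRLMonoid d A }.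

Declare Scope srl_scope.
Delimit Scope srl_scope with srl.
Notation "a ~> b" := (srl_imp a b)
  (at level 55, right associativity) : srl_scope.
Local Open Scope srl_scope.

Record subalgebra (d : Order.disp_t) (A : srlMonoidType d) (H : set A) :
    Prop := Subalgebra {
  subalgebra_cl :> cl_subalgebra H;
  sub_imp : forall a b, H a -> H b -> H (a ~> b)
}.

Record convex_subalgebra (d : Order.disp_t) (A : srlMonoidType d)
    (H : set A) : Prop := ConvexSubalgebra {
  convex_sub :> subalgebra H;
  sub_convex : forall a b c, H a -> H b -> a <= c -> c <= b -> H c
}.

Record strongly_convex_subalgebra (d : Order.disp_t) (A : srlMonoidType d)
    (H : set A) : Prop := StronglyConvexSubalgebra {
  strongly_convex_convex :> convex_subalgebra H;
  sub_strong : forall a h, H h -> a * h <= 1 -> 1 <= h ~> a -> H a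
}.

Definition compatible2 (T : Type) (theta : set (T * T)) (op : T -> T -> T) :
    Prop :=
  forall a b c d, theta (a, b) -> theta (c, d) -> theta (op a c, op b d).

Record congruence (d : Order.disp_t) (A : srlMonoidType d)
    (theta : set (A * A)) : Prop := Congruence {
  cong_equiv : Equivalence (fun a b => theta (a, b));
  cong_meet : compatible2 theta Order.meet;
  cong_join : compatible2 theta Order.join;
  cong_mul  : compatible2 theta *%g;
  cong_imp  : compatible2 theta srl_imp
}.

(** [asbool] (notation [`[< P >]]) makes the two types below MathComp subtypes
    of a powerset; they are ordered by restricting the powerset order, hence by
    inclusion, see [le_ConE] and [le_SCSubE]. *)
Record Con (d : Order.disp_t) (A : srlMonoidType d) : Type := MkCon {
  con_rel : set (A * A);
  con_relP : `[< congruence con_rel >]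
}.

Record SCSub (d : Order.disp_t) (A : srlMonoidType d) : Type := MkSCSub {
  scsub_set : set A;
  scsub_setP : `[< strongly_convex_subalgebra scsub_set >]
}.

Section SubsetOrders.
Context (d : Order.disp_t) (A : srlMonoidType d).

HB.instance Definition _ := [isSub for @con_rel d A].
HB.instance Definition _ := [Choice of Con A by <:].
HB.instance Definition _ := [SubChoice_isSubPOrder of Con A by <: with set_display].

HB.instance Definition _ := [isSub for @scsub_set d A].
HB.instance Definition _ := [Choice of SCSub A by <:].
HB.instance Definition _ := [SubChoice_isSubPOrder of SCSub A by <: with set_display].

Lemma le_ConE (theta phi : Con A) :
  (theta <= phi) = (con_rel theta `<=` con_rel phi)%classic :> Prop.
Proof. by rewrite -subsetEset Order.le_val. Qed.

Lemma le_SCSubE (H K : SCSub A) :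
  (H <= K) = (scsub_set H `<=` scsub_set K)%classic :> Prop.
Proof. by rewrite -subsetEset Order.le_val. Qed.

Lemma congruence_bigI (F : set (set (A * A))) :
  (F `<=` [set theta | congruence theta])%classic ->
  congruence (\bigcap_(theta in F) theta)%classic.
Proof.
move=> Fc; split.
- split.
  + by move=> a t /Fc [[r _ _] _ _ _ _]; exact: r.
  + by move=> a b ab t Ft; have [[_ s _] _ _ _ _] := Fc _ Ft; exact: s (ab _ Ft).
  + move=> a b c ab bc t Ft; have [[_ _ tr] _ _ _ _] := Fc _ Ft.
    exact: tr (ab _ Ft) (bc _ Ft).
- by move=> a b c e ab ce t Ft; apply: (cong_meet (Fc _ Ft)); [exact: ab|exact: ce].
- by move=> a b c e ab ce t Ft; apply: (cong_join (Fc _ Ft)); [exact: ab|exact: ce].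
- by move=> a b c e ab ce t Ft; apply: (cong_mul (Fc _ Ft)); [exact: ab|exact: ce].
- by move=> a b c e ab ce t Ft; apply: (cong_imp (Fc _ Ft)); [exact: ab|exact: ce].
Qed.

Definition con_bigI (F : set (set (A * A)))
    (Fc : (F `<=` [set theta | congruence theta])%classic) : Con A :=
  MkCon (asboolT (congruence_bigI Fc)).

Lemma con_val (theta : Con A) : congruence (con_rel theta).
Proof. exact: asboolW (con_relP theta). Qed.

Let meet_fam (theta phi : Con A) : set (set (A * A)) :=
  [set con_rel theta; con_rel phi]%classic.
Let join_fam (theta phi : Con A) : set (set (A * A)) :=
  [set psi | [/\ congruence psi, con_rel theta `<=` psi & con_rel phi `<=` psi]]%classic.

Lemma meet_fam_cong theta phi :
  (meet_fam theta phi `<=` [set psi | congruence psi])%classic.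
Proof. by move=> psi [->|->]; exact: con_val. Qed.

Lemma join_fam_cong theta phi :
  (join_fam theta phi `<=` [set psi | congruence psi])%classic.
Proof. by move=> psi []. Qed.

Definition con_meet theta phi := con_bigI (@meet_fam_cong theta phi).
Definition con_join theta phi := con_bigI (@join_fam_cong theta phi).

Lemma con_meetP (x y z : Con A) :
  (x <= con_meet y z) = (x <= y) && (x <= z).
Proof.
apply/idP/andP => [|[]]; rewrite !le_ConE /=.
  by move=> xyz; split=> p /xyz h; apply: h; [left|right].
by move=> xy xz p xp t [->|->]; [exact: xy|exact: xz].
Qed.

Lemma con_joinP (x y z : Con A) :
  (con_join x y <= z) = (x <= z) && (y <= z).
Proof.
apply/idP/andP => [|[]]; rewrite !le_ConE /=.
  by move=> xyz; split=> p xp; apply: xyz => t [_ xt yt]; [exact: xt|exact: yt].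
by move=> xz yz p; apply; split=> //; exact: con_val.
Qed.

HB.instance Definition _ :=
  Order.POrder_MeetJoin_isLattice.Build set_display (Con A) con_meetP con_joinP.

End SubsetOrders.

Definition one_class (d : Order.disp_t) (A : srlMonoidType d)
    (theta : set (A * A)) : set A :=
  [set a | theta (a, 1)]%classic.

Definition theta_of (d : Order.disp_t) (A : srlMonoidType d) (H : set A) :
    set (A * A) :=
  [set ab | exists2 h, H h & ab.1 * h <= ab.2 /\ ab.2 * h <= ab.1]%classic.

(* Main.v *)
Require Import Defs.

(** For [q] in the hidden subalgebra [Q], [a * q <= b] iff [q <= a ~> b]; every
    [a ~> b] lies in [Q], so [1 ~> h <= h] replaces any element [h] of a
    subalgebra [H] by a smaller one in [Q] and [H], which makes [theta_of H]
    compatible with [~>]. The two maps are mutually inverse thanks to two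
    witnesses: [(a ~> 1) `&` a] for [a] in [H], and
    [(a ~> b) `&` (b ~> a) `&` 1] for a pair [(a, b)] in [theta]. *)

Import Order.TTheory.

Set Implicit Arguments.
Unset Strict Implicit.
Unset Printing Implicit Defensive.

Local Open Scope group_scope.
Local Open Scope order_scope.
Local Open Scope srl_scope.

(** * Monotonicity of the product, and the implication *)

Section CLMonoidTheory.
Context (d : Order.disp_t) (A : clMonoidType d).
Implicit Types a b c : A.

Lemma clmul_le2r c a b : a <= b -> a * c <= b * c.
Proof. by rewrite !leEjoin -clmul_joinl => /eqP ->. Qed.

Lemma clmul_le2l c a b : a <= b -> c * a <= c * b.
Proof. by rewrite ![c * _]clmulC; exact: clmul_le2r. Qed.

Lemma clmul_le2 a b c e : a <= b -> c <= e -> a * c <= b * e.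
Proof. by move=> /(clmul_le2r c) ab /(clmul_le2l b); exact: le_trans. Qed.

End CLMonoidTheory.

Section SRLMonoidTheory.
Context (d : Order.disp_t) (A : srlMonoidType d).
Implicit Types a b c : A.

Lemma srl_mul_imp a b : a * (a ~> b) <= b.
Proof. by have [Q [_ /(_ a b)[[]]]] := @srl_impP d A. Qed.

Lemma srl_imp1_le b : 1 ~> b <= b.
Proof. by have := srl_mul_imp 1 b; rewrite mul1g. Qed.

Lemma srl_le_imp1 a b : (1 <= a ~> b) = (a <= b).
Proof.
have [Q [Qsub /(_ a b)[_ ub]]] := @srl_impP d A.
apply/idP/idP => [/(clmul_le2l a)|ab].
  by rewrite mulg1 => /le_trans; apply; exact: srl_mul_imp.
by apply: ub; split; [exact: sub_one|rewrite mulg1].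
Qed.

Lemma srl_imp11 : 1 ~> 1 = 1 :> A.
Proof. by apply/le_anti; rewrite srl_imp1_le srl_le_imp1 lexx. Qed.

(** The left factor is a product of two elements of [Q], hence lies in [Q], so the maximality that
    defines [b ~> e] applies to it. *)
Lemma srl_le_imp_mul a b c e m :
  b * ((a ~> c) * (1 ~> m)) <= e -> (a ~> c) * (1 ~> m) <= b ~> e.
Proof.
have [Q [Qsub Qmax]] := @srl_impP d A => le_e.
have [[Qac _] _] := Qmax a c; have [[Qm _] _] := Qmax 1 m.
by have [_] := Qmax b e; apply; split=> //; exact: sub_mul.
Qed.

(** * From congruences to strongly convex subalgebras *)

Section OneClass.
Variable theta : set (A * A).
Hypothesis thetaC : congruence theta.

Let refl a : theta (a, a).
Proof. by have [[r _ _] _ _ _ _] := thetaC; exact: r. Qed.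

Let sym a b : theta (a, b) -> theta (b, a).
Proof. by have [[_ s _] _ _ _ _] := thetaC; exact: s. Qed.

Let trans a b c : theta (a, b) -> theta (b, c) -> theta (a, c).
Proof. by have [[_ _ t] _ _ _ _] := thetaC; exact: t. Qed.

Lemma one_class_subalgebra : subalgebra (one_class theta).
Proof.
split; [split|] => [|a b|a b|a b|a b]; rewrite /one_class /=.
- exact: refl.
- by move=> /(cong_mul thetaC) h /h; rewrite mul1g.
- by move=> /(cong_meet thetaC) h /h; rewrite meetxx.
- by move=> /(cong_join thetaC) h /h; rewrite joinxx.
- by move=> /(cong_imp thetaC) h /h; rewrite srl_imp11.
Qed.

(** For [a <= c <= b], replacing [b] and [a] by 1 in [c = c /\ b] and [c = c \/ a] makes [c]
    congruent to [c /\ 1] and to [c \/ 1]; absorption concludes. *)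
Lemma one_class_convex : convex_subalgebra (one_class theta).
Proof.
split; first exact: one_class_subalgebra.
move=> a b c; rewrite /one_class /= => a1 b1 ac cb.
have := cong_meet thetaC (refl c) b1; rewrite (meet_l cb) => c_meet.
have := cong_join thetaC (refl c) a1; rewrite (join_l ac) => c_join.
apply: (trans c_meet); have := cong_meet thetaC c_join (refl 1).
by rewrite (meet_r (leUr 1 c)).
Qed.

(** Replacing [h] by 1 in the two hypotheses puts [a \/ 1] and [(1 ~> a) /\ 1] in the class; [a]
    lies between them. *)
Lemma one_class_strongly_convex : strongly_convex_subalgebra (one_class theta).
Proof.
split; first exact: one_class_convex.
move=> a h; rewrite /one_class /= => h1 ah1 h_a.
have aU1 : theta (a `|` 1, 1).
  have := cong_join thetaC (cong_mul thetaC (refl a) h1) (refl 1).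
  by rewrite (join_r ah1) mulg1 => /sym.
have aI1 : theta ((1 ~> a) `&` 1, 1).
  have := cong_meet thetaC (cong_imp thetaC h1 (refl a)) (refl 1).
  by rewrite (meet_r h_a) => /sym.
apply: (sub_convex one_class_convex aI1 aU1); last exact: leUl.
exact: le_trans (leIl _ _) (srl_imp1_le a).
Qed.

Lemma theta_of_one_class : theta_of (one_class theta) = theta.
Proof.
apply/seteqP; split => -[a b]; rewrite /theta_of /one_class /=.
  move=> [h h1 [ah_b bh_a]].
  (* Replace [h] by 1 in [(a * h) \/ b = b]. *)
  have b_ab : theta (b, a `|` b).
    have := cong_join thetaC (cong_mul thetaC (refl a) h1) (refl b).
    by rewrite (join_r ah_b) mulg1.
  have a_ab : theta (a, a `|` b).
    have := cong_join thetaC (refl a) (cong_mul thetaC (refl b) h1).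
    by rewrite (join_l bh_a) mulg1.
  exact: trans a_ab (sym b_ab).
(* Replacing [a] by [b] turns the witness into [(b ~> b) /\ 1], which is 1 since [1 <= b ~> b]. *)
move=> ab; exists ((a ~> b) `&` (b ~> a) `&` 1).
  have imp_b : theta ((a ~> b) `&` (b ~> a) `&` 1,
      (b ~> b) `&` (b ~> b) `&` 1).
    apply: (cong_meet thetaC _ (refl 1)); apply: (cong_meet thetaC).
      exact: (cong_imp thetaC ab (refl b)).
    exact: (cong_imp thetaC (refl b) ab).
  have one_le : 1 <= b ~> b by rewrite srl_le_imp1.
  by move: imp_b; rewrite meetxx (meet_r one_le).
split; [apply: (le_trans _ (srl_mul_imp a b))|
  apply: (le_trans _ (srl_mul_imp b a))].
  by apply: clmul_le2l; rewrite -meetA leIl.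
by apply: clmul_le2l; rewrite meetAC leIr.
Qed.

End OneClass.

(** * From subalgebras to congruences *)

Section ThetaOf.
Variable H : set A.

Lemma theta_of_sym a b : theta_of H (a, b) -> theta_of H (b, a).
Proof. by move=> [h Hh [/= ab ba]]; exists h. Qed.

Hypothesis Hsub : subalgebra H.

(** The meet of two witnesses serves both pairs, as the product is monotone. *)
Lemma theta_of2 a b c e : theta_of H (a, b) -> theta_of H (c, e) ->
  exists2 h, H h & [/\ a * h <= b, b * h <= a, c * h <= e & e * h <= c].
Proof.
move=> [h Hh [/= ab ba]] [k Hk [/= ce ec]]; exists (h `&` k).
  exact: (sub_meet Hsub).
have hk := leIl h k; have kh := leIr k h.
by split; [apply: (le_trans _ ab)|apply: (le_trans _ ba)|apply: (le_trans _ ce)|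
  apply: (le_trans _ ec)]; exact: clmul_le2l.
Qed.

Lemma theta_of_congruence : congruence (theta_of H).
Proof.
split.
- split=> [a|a b|a b c].
  + by exists 1; [exact: (sub_one Hsub)|rewrite /= mulg1].
  + exact: theta_of_sym.
  + move=> /theta_of2 ab /ab [h Hh [ah_b bh_a bh_c ch_b]].
    (* One factor [h] for each link of the chain from [a] to [c]. *)
    exists (h * h); first exact: (sub_mul Hsub).
    rewrite /= !mulgA; split.
      by apply: (le_trans _ bh_c); exact: clmul_le2r.
    by apply: (le_trans _ bh_a); exact: clmul_le2r.
- move=> a b c e /theta_of2 ab /ab [h Hh [ab_h ba_h ce_h ec_h]].
  exists h => //=; rewrite !lexI; split; apply/andP; split.
  + by apply: (le_trans _ ab_h); apply: clmul_le2r; exact: leIl.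
  + by apply: (le_trans _ ce_h); apply: clmul_le2r; exact: leIr.
  + by apply: (le_trans _ ba_h); apply: clmul_le2r; exact: leIl.
  + by apply: (le_trans _ ec_h); apply: clmul_le2r; exact: leIr.
- move=> a b c e /theta_of2 ab /ab [h Hh [ab_h ba_h ce_h ec_h]].
  by exists h => //=; rewrite !clmul_joinl !leU2.
- move=> a b c e /theta_of2 ab /ab [h Hh [ab_h ba_h ce_h ec_h]].
  exists (h * h); first exact: (sub_mul Hsub).
  have mulACA x y : (x * y) * (h * h) = (x * h) * (y * h).
    by rewrite -!mulgA; congr (x * _); rewrite !mulgA (clmulC y).
  by rewrite /= !mulACA !clmul_le2.
- move=> a b c e /theta_of2 ab /ab [h Hh [ab_h ba_h ce_h ec_h]].
  (* After bounding [1 ~> (h * h)] by [h * h], one [h] takes [y] below [x], so that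
     [x * (x ~> z) <= z]; the other takes [z] below [t]. *)
  have imp_le x y z t : y * h <= x -> z * h <= t ->
      (x ~> z) * (1 ~> (h * h)) <= y ~> t.
    move=> yx zt; apply: srl_le_imp_mul; apply: (le_trans _ zt).
    rewrite mulgA; apply: (@le_trans _ _ (y * (x ~> z) * (h * h))).
      exact/clmul_le2l/srl_imp1_le.
    rewrite mulgA; apply: clmul_le2r.
    rewrite -mulgA [_ * h]clmulC mulgA.
    exact: le_trans (clmul_le2r _ yx) (srl_mul_imp x z).
  exists (1 ~> (h * h)); last by split; exact: imp_le.
  by apply: (sub_imp Hsub); [exact: (sub_one Hsub)|exact: (sub_mul Hsub)].
Qed.

End ThetaOf.

(** Being related to 1 through [h] means [a * h <= 1] and [h <= a], that is [1 <= h ~> a]: the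
    premises of strong convexity. *)
Lemma one_class_theta_of (H : set A) : strongly_convex_subalgebra H ->
  one_class (theta_of H) = H.
Proof.
move=> Hsc; apply/seteqP; split => a; rewrite /one_class /theta_of /=.
  move=> [h Hh [ah1]]; rewrite mul1g => h_a.
  by apply: (sub_strong Hsc Hh ah1); rewrite srl_le_imp1.
(* The first meetand gives [a * h <= 1], the second [h <= a]. *)
move=> Ha; exists ((a ~> 1) `&` a).
  apply: (sub_meet Hsc) => //; apply: (sub_imp Hsc) => //.
  exact: (sub_one Hsc).
rewrite mul1g leIr; split=> //.
by apply: (le_trans _ (srl_mul_imp a 1)); apply: clmul_le2l; exact: leIl.
Qed.

(** * The order isomorphism *)

Lemma scsub_val (H : SCSub A) : strongly_convex_subalgebra (scsub_set H).
Proof. exact: asboolW (scsub_setP H). Qed.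

Definition con_one_class (theta : Con A) : SCSub A :=
  MkSCSub (asboolT (one_class_strongly_convex (con_val theta))).

Definition scsub_theta (H : SCSub A) : Con A :=
  MkCon (asboolT (theta_of_congruence (scsub_val H))).

Lemma con_one_classK : cancel con_one_class scsub_theta.
Proof. by move=> t; apply/val_inj/theta_of_one_class/con_val. Qed.

Lemma scsub_thetaK : cancel scsub_theta con_one_class.
Proof. by move=> H; apply/val_inj/one_class_theta_of/scsub_val. Qed.

Lemma con_one_class_le : {homo con_one_class : theta phi / theta <= phi}.
Proof. by move=> t p; rewrite le_ConE le_SCSubE => tp a /tp. Qed.

Lemma scsub_theta_le : {homo scsub_theta : H K / H <= K}.
Proof.
move=> H K; rewrite le_ConE le_SCSubE => HK [a b] [h Hh ab].
by exists h => //; exact: HK.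
Qed.

End SRLMonoidTheory.

Theorem theorem3p7 (d : Order.disp_t) (A : srlMonoidType d) :
  exists (f : Con A -> SCSub A) (g : SCSub A -> Con A),
    [/\ forall theta : Con A, scsub_set (f theta) = one_class (con_rel theta),
        forall H : SCSub A, con_rel (g H) = theta_of (scsub_set H),
        cancel f g,
        cancel g f
      & {mono f : theta phi / theta <= phi}].
Proof.
exists (@con_one_class d A), (@scsub_theta d A); split=> //.
- exact: con_one_classK.
- exact: scsub_thetaK.
(* The order is reflected because the inverse map is monotone too. *)
move=> t p; apply/idP/idP; last exact: con_one_class_le.
by move=> /scsub_theta_le; rewrite !con_one_classK.
Qed.
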